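(* For a set of reals $X\subseteq\mathbb R$, the following are equivalent: (1) $X$ satisfies $\mathsf S_{fin}(\Omega,\Omega^{gp})$ and has strong measure zero; (2) $X$ satisfies $\mathsf S_{fin}(\Omega,\Omega^{gp})$ and $\mathsf S_1(\mathcal O,\mathcal O)$; (3) $X$ satisfies $\mathsf S_{fin}(\Omega,\Omega^{gp})$ and is meager-additive; (4) $X$ satisfies $\mathsf S_{fin}(\Omega,\Omega^{gp})$ and $\mathsf S_1(\Omega,\Omega)$; (5) $X$ satisfies $\mathsf S_1(\Omega,\Omega^{gp})$.
   Context: A metric space $X$ has strong measure zero if for each sequence $\{\epsilon_n\}_{n\in\mathbb N}$ of positive reals there is a cover $\{I_n\}_{n\in\mathbb N}$ of $X$ such that $\operatorname{diam}(I_n)<\epsilon_n$ for all $n$ (subsets of $\mathbb R$ carry the usual metric). A set $X\subseteq\mathbb R$ is meager-additive if for each meager $M\subseteq\mathbb R$, $X+M=\{x+m:x\in X,\ m\in M\}$ is meager in $\mathbb R$. For a topological space $X$ (here $X$ with the subspace topology): an open cover $\mathcal U$ of $X$ is an $\omega$-cover if $X\notin\mathcal U$ and for each finite $F\subseteq X$ there is $U\in\mathcal U$ with $F\subseteq U$. $\mathcal O$ and $\Omega$ denote the collections of all countable open covers and all countable open $\omega$-covers of $X$, respectively. $\Omega^{gp}$ denotes the collection of open $\omega$-covers $\mathcal U$ of $X$ for which there exists a partition $\mathcal P$ of $\mathcal U$ into finite sets such that for each finite $F\subseteq X$ and all but finitely many $\mathcal F\in\mathcal P$, there exists $U\in\mathcal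 F$ with $F\subseteq U$. For collections $\mathscr A,\mathscr B$ of covers of $X$: $X$ satisfies $\mathsf S_1(\mathscr A,\mathscr B)$ if for each sequence $\{\mathcal U_n\}_{n\in\mathbb N}$ of members of $\mathscr A$ there exist $U_n\in\mathcal U_n$, $n\in\mathbb N$, such that $\{U_n:n\in\mathbb N\}\in\mathscr B$. $X$ satisfies $\mathsf S_{fin}(\mathscr A,\mathscr B)$ if for each sequence $\{\mathcal U_n\}_{n\in\mathbb N}$ of members of $\mathscr A$ there exist finite (possibly empty) $\mathcal F_n\subseteq\mathcal U_n$, $n\in\mathbb N$, such that $\bigcup_{n\in\mathbb N}\mathcal F_n\in\mathscr B$. *)

(* Defs.v *)
From HB Require Import structures.
From mathcomp Require Import all_boot all_order all_algebra.
From mathcomp Require Import all_classical all_reals all_analysis.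
Import Order.TTheory GRing.Theory Num.Theory.
Import numFieldNormedType.Exports.
Set Implicit Arguments.
Unset Strict Implicit.
Unset Printing Implicit Defensive.
Local Open Scope classical_set_scope.
Local Open Scope ring_scope.

(* A family of covers of a space T is a [set (set (set T))].  The definitions
   are stated for an arbitrary space T; a subspace X of a space Y is the type
   [set_type X], whose topology in the library is the initial topology of the
   inclusion into Y. *)

(* The condition [U !=set0] only matters when T is empty (otherwise it follows
   from the covering condition).  It rules out the empty family as a cover of
   the empty space, from which no selection U_n \in \mathcal U_n would exist. *)
Definition open_cover (T : topologicalType) (U : set (set T)) : Prop :=
  [/\ U !=set0, (forall V, U V -> open V) & cover U id = setT].

Definition omega_cover (T : topologicalType) (U : set (set T)) : Prop :=
  [/\ open_cover U, ~ U setT &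
      forall F : set T, finite_set F -> exists2 V, U V & F `<=` V].

Definition OpenCov (T : topologicalType) : set (set (set T)) :=
  [set U | open_cover U /\ countable U].
Arguments OpenCov T : clear implicits.

Definition Omega (T : topologicalType) : set (set (set T)) :=
  [set U | omega_cover U /\ countable U].
Arguments Omega T : clear implicits.

Definition Omega_gp (T : topologicalType) : set (set (set T)) :=
  [set U | omega_cover U /\
    exists P : set (set (set T)),
      [/\ partition P id U,
          (forall G, P G -> finite_set G) &
          forall F : set T, finite_set F ->
            finite_set [set G | P G /\ ~ exists2 V, G V & F `<=` V]]].
Arguments Omega_gp T : clear implicits.

Definition S1 (T : Type) (A B : set (set (set T))) : Prop :=
  forall U : nat -> set (set T), (forall n, A (U n)) ->
    exists2 V : nat -> set T, (forall n, U n (V n)) & B (range V).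

Definition Sfin (T : Type) (A B : set (set (set T))) : Prop :=
  forall U : nat -> set (set T), (forall n, A (U n)) ->
    exists2 F : nat -> set (set T),
      (forall n, F n `<=` U n /\ finite_set (F n)) & B (\bigcup_n F n).

(* Adjoining 0 gives the empty set diameter 0 instead of -oo. *)
Definition diam (R : realType) (A : set R) : \bar R :=
  ereal_sup (0%E |` [set `|x - y|%:E | x in A & y in A]).

Definition strong_measure_zero (R : realType) (X : set R) : Prop :=
  forall e : nat -> R, (forall n, 0 < e n) ->
    exists2 I : nat -> set R,
      \bigcup_n I n = X & forall n, (diam (I n) < (e n)%:E)%E.

Definition nowhere_dense (T : topologicalType) (A : set T) : Prop :=
  (closure A)° = set0.

Definition meager (T : topologicalType) (M : set T) : Prop :=
  exists2 A : nat -> set T, (forall n, nowhere_dense (A n)) &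
    M = \bigcup_n A n.

Definition meager_additive (R : realType) (X : set R) : Prop :=
  forall M : set R, meager M -> meager [set x + m | x in X & m in M].

(* Main.v *)
Require Import Defs.
From mathcomp Require Import all_boot all_order all_algebra.
From mathcomp Require Import all_classical all_reals all_analysis.
From mathcomp Require Import lra.
Import Order.TTheory GRing.Theory Num.Theory.
Import numFieldNormedType.Exports.
Set Implicit Arguments.
Unset Strict Implicit.
Unset Printing Implicit Defensive.
Local Open Scope classical_set_scope.
Local Open Scope ring_scope.

(** The five conditions are compared through two properties of X.

    The first, [omega_hurewicz], is a selection property with pointwise
    eventual capture: out of omega-covers U_0, U_1, ... one can take finite
    parts such that every finite subset of X lies in a chosen member of U_n for
    almost all n.  It follows from Sfin(Omega, Omega^gp): refine U_n by
    intersections with the earlier covers, and feed the finite blocks of the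
    groupable cover that Sfin provides back into the rows
    ([Sfin_Omega_gp_hurewicz]).

    The second, [small_balls], is strong measure zero with the small sets
    replaced by balls.  It follows from S1(O, O) by covering X with balls of
    radius e_n, and from meager-additivity because a meager set M with
    X + M <> R can be chosen as the complement of a dense union of small balls;
    this is the easy half of the Galvin-Mycielski-Solovay theorem.

    The two properties together give everything else.  The link is
    [hurewicz_small_balls_blocks]: the radii can be cut into finite consecutive
    blocks such that every point is covered within almost every block.

    - Meager-additivity.  If C is bounded and nowhere dense, then, uniformly in
      the position, every interval of length d contains one of length d' that
      keeps distance d' from C, and this is unaffected by translations.  With
      the numbers d iterated as radii, going through one block of balls shrinks
      a given interval to one that misses x + C for all x covered by the block.
      So X + C is a countable union of nowhere dense sets.

    - S1(Omega, Omega).  Blocks let one multiply small ball coverings: one ball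
      for a tuple of j points, repeated along a block for one more point.  Hence
      all finite powers of X, and so the finite subsets of X, have strong
      measure zero.  The Hurewicz property provides Lebesgue numbers r_n: every
      finite F has, for almost all n, its r_n-neighbourhood inside a member of
      U_n.  A finite set s_n that is r_n/2-close to F for some such n then
      determines a member of U_n containing F.

    Finally S1(Omega, Omega) and the Hurewicz property give
    S1(Omega, Omega^gp): the members selected from U_s, U_(s+1), ... form an
    omega-cover for every start s, and finitely many of them suffice eventually,
    which yields blocks.  To make the blocks disjoint as sets of sets, the
    selection depends on the whole history, and every new member must contain
    points omitted by the older ones. *)

(** * Choice, countability and coding of pairs *)

Lemma choice_in (A B : Type) (b : B) (D : set A) (P : A -> B -> Prop) :
  (forall a, D a -> exists b, P a b) ->
  exists f : A -> B, forall a, D a -> P a (f a).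
Proof.
move=> DP; suff /choice[f fP] : forall a, exists b, D a -> P a b by exists f.
move=> a; have [/DP[c Pc]|nDa] := pselect (D a); first by exists c.
by exists b.
Qed.

Lemma finite_set_nat_bound (T : Type) (A : set T) (f : T -> nat) :
  finite_set A -> exists M, forall x, A x -> (f x < M)%N.
Proof.
move=> /(finite_image f) /finite_seqP[s sE].
exists (\max_(i <- s) i).+1 => x Ax; rewrite ltnS.
have : [set f y | y in A] (f x) by exists x.
by rewrite sE /= => fxs; apply: (@leq_bigmax_seq _ s xpredT id).
Qed.

Lemma countType_range_countable (A : countType) (T : Type) (f : A -> T) :
  countable (range f).
Proof. exact/(card_le_trans (card_image_le _ _))/countableP. Qed.

Lemma countable_nonempty_range (T : Type) (A : set T) :
  countable A -> A !=set0 -> exists f : nat -> T, A = range f.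
Proof.
move=> /pfcard_geP[-> [x []]//|[f] _].
exists f; apply/seteqP; split.
- by move=> x /(@surj _ _ _ _ f)[n _ <-]; exists n.
- by move=> _ [n _ <-]; exact: funS.
Qed.

(** A bijective coding of pairs by 2^a (2b + 1) - 1, chosen because the code of
    (a, b) is at least a, so that large first components give large codes. *)
Definition pair_code (a b : nat) : nat := (2 ^ a * b.*2.+1).-1.

Definition pair_decode (n : nat) : nat * nat :=
  (logn 2 n.+1, (n.+1 %/ 2 ^ logn 2 n.+1)./2).

Lemma pair_codeK a b : pair_decode (pair_code a b) = (a, b).
Proof.
rewrite /pair_decode /pair_code prednK; last by rewrite muln_gt0 expn_gt0.
have -> : logn 2 (2 ^ a * b.*2.+1) = a.
  rewrite lognM ?expn_gt0// pfactorK// lognE/= dvdn2/= odd_double/=.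
  by rewrite addn0.
by rewrite mulKn ?expn_gt0//= uphalf_double.
Qed.

Lemma leq_pair_code a b : (a <= pair_code a b)%N.
Proof.
rewrite /pair_code -ltnS prednK; last by rewrite muln_gt0 expn_gt0.
by rewrite (leq_trans (ltn_expl a (isT : 1 < 2)%N))// leq_pmulr.
Qed.

(** * Enumerated omega-covers and the Hurewicz property *)

(** An omega-cover listed as a sequence.  The whole space may occur in the
    list, so that families of neighbourhoods can be used without checking that
    they consist of proper subsets. *)
Definition omega_seq (T : Type) (W : nat -> set T) : Prop :=
  forall F : set T, finite_set F -> exists i, F `<=` W i.

Definition omega_hurewicz (T : topologicalType) : Prop :=
  forall W : nat -> nat -> set T, (forall n i, open (W n i)) ->
    (forall n, omega_seq (W n)) ->
  exists g : nat -> nat, forall F, finite_set F ->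
    \forall n \near \oo, exists2 i, (i < g n)%N & F `<=` W n i.

Section covers.
Variable T : topologicalType.
Implicit Types (F V : set T) (W : nat -> set T) (U : set (set T)).

Lemma omega_cover_range (I : Type) (W : I -> set T) (i0 : I) :
  (forall i, open (W i)) -> (forall i, W i <> setT) ->
  (forall F, finite_set F -> exists i, F `<=` W i) -> omega_cover (range W).
Proof.
move=> oW WT cW; split => [|[i _ /WT]//|F /cW[i FW]]; last first.
  by exists (W i) => //; exists i.
split => [||]; first by exists (W i0), i0.
- by move=> _ [i _ <-].
- apply/seteqP; split => // x _.
  have [i /(_ x erefl) Wx] := cW _ (finite_set1 x).
  by exists (W i) => //; exists i.
Qed.

Lemma Omega_range U : Omega T U -> exists W,
  [/\ U = range W, (forall i, open (W i)), (forall i, W i <> setT) &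
      omega_seq W].
Proof.
move=> [[[U0 oU _] UT cU] /countable_nonempty_range/(_ U0)[W UE]].
exists W; split => // [i|i WiT|F /cU[V]].
- by apply: oU; rewrite UE; exists i.
- by apply: UT; rewrite UE; exists i.
- by rewrite UE => -[i _ <-]; exists i.
Qed.

(** A point omitted by each member of a finite family makes a finite set that
    no member contains. *)
Lemma omega_cover_infinite U : omega_cover U -> infinite_set U.
Proof.
move=> [_ UT cU] finU.
have /(choice_in set0)[p pP] :
    forall V, U V -> exists pV : set T, exists x, pV = [set x] /\ ~ V x.
  move=> V UV; have /existsNP[x Vx] : ~ forall x, V x.
    by move=> VT; apply: UT; rewrite (_ : setT = V)//; apply/seteqP; split.
  by exists [set x], x.
have [V UV pV] : exists2 V, U V & \bigcup_(V in U) p V `<=` V.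
  apply: cU; apply: bigcup_finite => // V /pP[x [-> _]]; exact: finite_set1.
have [x [pVx Vx]] := pP _ UV.
by apply: Vx; apply: pV; exists V => //; rewrite pVx.
Qed.

End covers.

Section hurewicz.
Variable T : topologicalType.
Hypothesis sfin : Sfin (Omega T) (Omega_gp T).

(** The row n is refined to the intersections of one set from each of the rows
    0, ..., n, so that a set selected at a stage n >= N is contained in a set
    of the row N.  The Nth selection is read off a block of the groupable cover
    that contains nothing selected before the stage N.  A block contains a set
    of some stage n, hence it serves only for N <= n; so the finitely many
    blocks that fail for a given finite set are harmful for finitely many N
    only. *)
Let hurewicz_proper (W : nat -> nat -> set T) :
  (forall n i, open (W n i)) -> (forall n i, W n i <> setT) ->
  (forall n, omega_seq (W n)) ->
  exists g : nat -> nat, forall F, finite_set F ->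
    \forall n \near \oo, exists2 i, (i < g n)%N & F `<=` W n i.
Proof.
move=> oW WT cW.
pose meet n (s : seq nat) := \bigcap_(m < n.+1) W m (nth 0%N s m).
have Omeet n : Omega T (range (meet n)).
  split; last exact: countType_range_countable.
  apply: (omega_cover_range [::]) => [s|s sT|F finF].
  - rewrite /meet bigcap_mkord; apply: big_ind => //; first exact: openT.
    exact: openI.
  - apply: (WT 0%N (nth 0%N s 0)); apply/seteqP; split => // x _.
    by have : meet n s x by [rewrite sT]; apply.
  - have [f Ff] := choice (fun m => cW m F finF).
    exists (mkseq f n.+1) => x Fx m /= mn.
    by rewrite nth_mkseq//; apply: Ff.
have [A AO [cA [P [[PA Ptriv P0] Pfin Pgp]]]] := sfin Omeet.
have infP : infinite_set P.
  move=> finP; apply: (omega_cover_infinite cA); rewrite -PA.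
  exact: bigcup_finite.
have Bex N : exists B, P B /\ forall n, (n < N)%N -> A n `&` B = set0.
  pose old := \bigcup_(n < N) A n.
  have finold : finite_set old.
    by apply: bigcup_finite => [|n _]; [exact: finite_II|case: (AO n)].
  (* A block meeting [old] is determined by a common element. *)
  have finmeet : finite_set [set B | P B /\ B `&` old !=set0].
    have /(choice_in set0)[h hP] : forall V, (exists B, P B /\ B V) ->
        exists B, P B /\ B V by [].
    apply: (sub_finite_set _ (finite_image h finold)) => B [PB [V [BV oV]]].
    exists V => //; have [PhV hVV] := hP V (ex_intro _ B (conj PB BV)).
    by apply: (Ptriv _ _ PhV PB); exists V.
  have /infinite_setN0[B [PB nB]] := infinite_setD infP finmeet.
  exists B; split => // n nN; apply/seteqP; split => // V [AV BV].
  by apply: nB; split => //; exists V; split => //; exists n.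
have [B BP] := choice Bex.
have idx N : exists f : set T -> nat, forall V, B N V -> V `<=` W N (f V).
  suff /(choice_in 0%N) : forall V, B N V -> exists i, V `<=` W N i by [].
  move=> V BV.
  have [n _ AnV] : (\bigcup_n A n) V.
    by rewrite -PA; exists (B N) => //; case: (BP N).
  have Nn : (N <= n)%N.
    rewrite leqNgt; apply/negP => nN.
    by have := (BP N).2 _ nN; move/seteqP => [/(_ V (conj AnV BV))].
  have [s _ <-] := (AO n).1 _ AnV.
  by exists (nth 0%N s N) => x; apply.
have [f fP] := choice idx.
have [g gP] := choice (fun N => finite_set_nat_bound (f N) (Pfin _ (BP N).1)).
exists g => F /Pgp finbad.
have /(choice_in 0%N)[first firstP] :
    forall G, P G -> exists n, exists2 V, G V & A n V.
  move=> G PG; have [V GV] := P0 _ PG.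
  have [n _ AnV] : (\bigcup_n A n) V by rewrite -PA; exists G.
  by exists n, V.
have [M MP] := finite_set_nat_bound first finbad.
exists M => // N /= MN; have [PB BA] := BP N.
have [[V BV FV]|nV] := pselect (exists2 V, B N V & F `<=` V).
  by exists (f N V); [exact: gP|exact: subset_trans (fP _ _ BV)].
have /= lt_first := MP _ (conj PB nV).
have [V BV AV] := firstP _ PB.
have := BA _ (leq_trans lt_first MN).
by move/seteqP => [/(_ V (conj AV BV))].
Qed.

(** A row in which the whole space occurs needs no selection; it is replaced by
    a row of proper subsets, if there is one, to reduce to that case. *)
Lemma Sfin_Omega_gp_hurewicz : omega_hurewicz T.
Proof.
move=> W oW cW.
pose full n := exists i, W n i = setT.
have /(choice_in 0%N)[d dP] : forall n, full n -> exists i, W n i = setT by [].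
have [allfull|/existsNP[m mfull]] := pselect (forall n, full n).
  exists (fun n => (d n).+1) => F _; exists 0%N => // n _.
  by exists (d n) => //; rewrite dP.
pose k n := if `[< full n >] then m else n.
have [n i kT|g gP] := hurewicz_proper (fun n => oW (k n)) _ (fun n => cW (k n)).
  rewrite /k in kT; case: asboolP kT => [_ mT|nfull nT].
    by apply: mfull; exists i.
  by apply: nfull; exists i.
exists (fun n => if `[< full n >] then (d n).+1 else g n) => F /gP[N _ NP].
exists N => // n /NP; rewrite /k; case: asboolP => // fn _.
by exists (d n) => //; rewrite dP.
Qed.

End hurewicz.

(** * Sequences built block by block *)

(** A stage depends on everything constructed before it: [c h] proposes a
    continuation of the history [h], and [g h] tells how much of it is kept; the
    successor makes the blocks nonempty. *)
Lemma block_sequence (A : Type) (c : seq A -> nat -> A) (g : seq A -> nat) :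
  exists (v : nat -> A) (m : nat -> nat),
    [/\ m 0%N = 0%N, forall k, m k.+1 = (m k + (g (mkseq v (m k))).+1)%N &
        forall k n, (m k <= n < m k.+1)%N ->
          v n = c (mkseq v (m k)) (n - m k)%N].
Proof.
pose next h := h ++ mkseq (c h) (g h).+1.
pose h k := iter k next [::].
pose a0 := c [::] 0%N.
have hS k : h k.+1 = next (h k) by [].
have sizeS k : size (h k.+1) = (size (h k) + (g (h k)).+1)%N.
  by rewrite hS size_cat size_mkseq.
have nth_h k d n : (n < size (h k))%N ->
    nth a0 (h (d + k)%N) n = nth a0 (h k) n.
  elim: d => // d IH nk; rewrite addSn hS nth_cat IH// ifT//.
  rewrite (leq_trans nk)//; elim: d {IH} => // d /leq_trans; apply.
  by rewrite addSn sizeS leq_addr.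
have leq_size k : (k <= size (h k))%N.
  by elim: k => // k IH; rewrite sizeS addnS ltnS (leq_trans IH)// leq_addr.
pose v n := nth a0 (h n.+1) n.
have vE k n : (n < size (h k))%N -> v n = nth a0 (h k) n.
  move=> nk; rewrite /v -(nth_h _ n.+1 _ nk) addnC.
  by rewrite (nth_h n.+1)//; exact: leq_size.
have mkE k : mkseq v (size (h k)) = h k.
  apply: (@eq_from_nth _ a0); first by rewrite size_mkseq.
  by move=> i; rewrite size_mkseq => ik; rewrite nth_mkseq// (vE k).
exists v, (fun k => size (h k)); split => // [k|k n /andP[kn nk]].
  by rewrite mkE sizeS.
rewrite mkE (vE _ _ nk) hS nth_cat ltnNge kn/= nth_mkseq//.
by rewrite ltn_subLR// -sizeS.
Qed.

Section blocks.
Variable m : nat -> nat.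
Hypothesis m0 : m 0%N = 0%N.
Hypothesis mS : forall k, (m k < m k.+1)%N.

Lemma block_homo k k' : (k <= k')%N -> (m k <= m k')%N.
Proof.
by apply: (homo_leq (@leqnn) leq_trans) => i; exact: ltnW.
Qed.

Lemma block_ge k : (k <= m k)%N.
Proof. by elim: k => // k IH; exact: leq_ltn_trans (mS k). Qed.

Lemma block_exists n : exists k, (m k <= n < m k.+1)%N.
Proof.
elim: n => [|n [k /andP[kn nk]]].
  by exists 0%N; have := mS 0%N; rewrite m0 => ->.
have [nk'|kn'] := ltnP n.+1 (m k.+1).
  by exists k; rewrite nk' (leq_trans kn).
by exists k.+1; rewrite kn' (leq_ltn_trans nk).
Qed.

Lemma block_lt k k' n : (m k <= n)%N -> (n < m k'.+1)%N -> (k <= k')%N.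
Proof.
move=> kn nk'; rewrite leqNgt; apply/negP => /block_homo k'k.
by move: (leq_ltn_trans kn nk'); rewrite ltnNge k'k.
Qed.

Lemma block_unique k k' n :
  (m k <= n < m k.+1)%N -> (m k' <= n < m k'.+1)%N -> k = k'.
Proof.
move=> /andP[kn nk] /andP[kn' nk']; apply/eqP.
by rewrite eqn_leq (block_lt kn nk') (block_lt kn' nk).
Qed.

End blocks.

Lemma injective_near_ge (f : nat -> nat) N : injective f ->
  \forall k \near \oo, (N <= f k)%N.
Proof.
move=> injf; elim: N => [|N [K _ KP]]; first exact: nearW.
have [[k0 fk0]|nk0] := pselect (exists k, f k = N).
  exists (maxn K k0.+1) => // k; rewrite /= geq_max => /andP[Kk k0k].
  have /= := KP k Kk; rewrite leq_eqVlt => /orP[/eqP fkN|//].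
  by move: k0k; rewrite (injf k0 k) ?ltnn// -fkN.
exists K => // k /KP /=; rewrite leq_eqVlt => /orP[/eqP fkN|//].
by exfalso; apply: nk0; exists k.
Qed.

(** * From S1(Omega, Omega) to S1(Omega, Omega^gp) *)

Section selection.
Variable T : topologicalType.

(** A partition of [range V] concerns sets, not indices: if a set were repeated
    in a later block, it could be kept in only one of the two blocks, and the
    other one might no longer capture the given finite set.  This is why the
    sets of a block have to be different from the earlier ones. *)
Lemma groupable_range (V : nat -> set T) (m : nat -> nat) :
  m 0%N = 0%N -> (forall k, (m k < m k.+1)%N) ->
  (forall n, open (V n)) -> (forall n, V n <> setT) ->
  (forall k n n', (m k <= n)%N -> (n' < m k)%N -> V n <> V n') ->
  (forall F, finite_set F -> \forall k \near \oo,
     exists2 n, (m k <= n < m k.+1)%N & F `<=` V n) ->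
  Omega_gp T (range V).
Proof.
move=> m0 mS oV VT Vnew Vgp; split.
  apply: (omega_cover_range 0%N) => // F /Vgp[k _ /(_ k (leqnn k))[n _ FV]].
  by exists n.
pose B k := V @` [set n | (m k <= n < m k.+1)%N].
exists (range B); split => [||F /Vgp[K _ KP]].
- split => [|_ _ [k _ <-] [k' _ <-]|_ [k _ <-]].
  + apply/seteqP; split => [_ [_ [k _ <-] [n _ <-]]|_ [n _ <-]].
      by exists n.
    have [k kn] := block_exists m0 mS n.
    by exists (B k); [exists k|exists n].
  + move=> [_ [[n kn <-] [n' kn' VE]]]; congr B.
    wlog : k k' n n' kn kn' VE / (n' <= n)%N.
      move=> wl; have [|/ltnW nn'] := leqP n' n; first exact: wl.
      by rewrite (wl k' k n' n).
    move=> nn'; apply/eqP; rewrite eqn_leq; apply/andP; split.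
      rewrite leqNgt; apply/negP => k'k; case/andP: kn => kn _.
      case/andP: kn' => _ kn'; apply: (Vnew k n n' kn _ (esym VE)).
      exact: (leq_trans kn' (block_homo mS k'k)).
    case/andP: kn => _ kn; case/andP: kn' => kn' _.
    exact: (block_lt mS (leq_trans kn' nn') kn).
  + by exists (V (m k)), (m k) => //=; rewrite leqnn mS.
- move=> _ [k _ <-]; apply: finite_image.
  by apply: (sub_finite_set _ (finite_II (m k.+1))) => n /andP[].
- apply: (sub_finite_set _ (finite_image B (finite_II K))).
  move=> _ [[k _ <-] nV]; exists k => //=; rewrite ltnNge; apply/negP => Kk.
  by apply: nV; have [n kn FV] := KP k Kk; exists (V n) => //; exists n.
Qed.

(** After the history h of length s, the sets selected from the rows s, s + 1,
    ... by S1(Omega, Omega) form an omega-cover; those that do not contain one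
    omitted point for each set of the history are replaced by sets that do.
    This is still an omega-cover, since a finite set F is captured together
    with these points.  There are countably many histories, so the Hurewicz
    property bounds, for all of them at once, how far the selection has to be
    followed: a given finite set is captured for almost all histories, in
    particular for almost all of those that occur in the construction. *)
Lemma S1_Omega_gp :
  omega_hurewicz T -> S1 (Omega T) (Omega T) -> S1 (Omega T) (Omega_gp T).
Proof.
move=> hur roth U UO.
have /choice[W WP] := fun n => Omega_range (UO n).
have oW n i : open (W n i) by case: (WP n).
have WT n i : W n i <> setT by case: (WP n).
have cW n : omega_seq (W n) by case: (WP n).
have /choice[p pP] : forall ni, exists x, ~ W ni.1 ni.2 x.
  move=> [n i]; apply/existsNP => WniT.
  by apply: (WT n i); apply/seteqP; split.
have /choice[j jP] : forall s, exists j, omega_seq (fun n => W (s + n)%N (j n)).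
  move=> s; have [V VU [[_ _ cV] _]] :=
    roth (fun n => U (s + n)%N) (fun n => UO _).
  have /choice[j jV] : forall n, exists i, V n = W (s + n)%N i.
    move=> n; move: (VU n).
    by case: (WP (s + n)%N) => -> _ _ _ [i _ <-]; exists i.
  exists j => F /cV[_ [n _ <-]]; rewrite jV => FW; by exists n.
pose pts (h : seq nat) := [set p (n, nth 0%N h n) | n in `I_(size h)].
have finpts h : finite_set (pts h) by apply: finite_image; exact: finite_II.
have /choice[c cP] : forall hn : seq nat * nat, exists i,
    pts hn.1 `<=` W (size hn.1 + hn.2)%N i /\
    (pts hn.1 `<=` W (size hn.1 + hn.2)%N (j (size hn.1) hn.2) ->
     i = j (size hn.1) hn.2).
  move=> [h n] /=.
  have [hj|hj] := pselect (pts h `<=` W (size h + n)%N (j (size h) n)).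
    by exists (j (size h) n).
  have [i hi] := cW (size h + n)%N _ (finpts h); by exists i.
pose W' k n : set T := if unpickle k is Some h
  then W (size h + n)%N (c (h, n)) else setT.
have [||g gP] := hur W'.
- by move=> k n; rewrite /W'; case: unpickle => [h|]; [exact: oW|exact: openT].
- move=> k F finF; rewrite /W'; case: unpickle => [h|]; last by exists 0%N.
  have /(jP (size h))[n] : finite_set (F `|` pts h) by rewrite finite_setU.
  rewrite subUset => -[Fn hn]; exists n.
  by have [_ /= ->] := cP (h, n).
have [v [m [m0 mS vE]]] :=
  block_sequence (fun h n => c (h, n)) (fun h => g (pickle h)).
have ltm k : (m k < m k.+1)%N by rewrite mS -addn1 leq_add2l.
exists (fun n => W n (v n)).
  by move=> n; case: (WP n) => -> _ _ _; exists (v n).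
apply: (groupable_range m0 ltm) => // [k n n' kn n'k VE|F /gP gF].
  have [k' /andP[kn' nk']] := block_exists m0 ltm n.
  have : pts (mkseq v (m k')) `<=` W n (v n).
    have [+ _] := cP (mkseq v (m k'), (n - m k')%N).
    by rewrite /= size_mkseq subnKC// -vE// kn' nk'.
  move=> /(_ (p (n', v n'))); rewrite VE => /(_ _)/(pP (n', v n')); apply.
  have n'k' : (n' < m k')%N.
    by apply: (leq_trans n'k); apply: block_homo => //; exact: block_lt kn nk'.
  by exists n'; rewrite /= ?size_mkseq// nth_mkseq.
have /injective_near_ge inf : injective (fun k => pickle (mkseq v (m k))).
  move=> k k' /(pcan_inj (@pickleK _))/(congr1 size); rewrite !size_mkseq => mE.
  have mk := ltm k; have mk' := ltm k'.
  by apply: (block_unique ltm (n := m k)); rewrite ?leqnn ?mE ?leqnn// -?mE.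
case: gF => N _ NP; have [K _ KP] := inf N.
exists K => // k /KP/NP[n]; rewrite /W' pickleK size_mkseq => ng FW.
have nk : (m k <= m k + n < m k.+1)%N.
  by rewrite leq_addr mS ltn_add2l ltnS ltnW.
by exists (m k + n)%N => //; rewrite (vE k)// addKn.
Qed.

End selection.

(** * Rothberger property and strong measure zero *)

(** The finite unions with one set from each of the covers numbered
    [pair_code n 0], [pair_code n 1], ... form an omega-cover, unless one of
    them is already the whole space.  Selecting one such union for each n
    selects one set from each cover. *)
Lemma S1_Omega_OpenCov (T : topologicalType) :
  S1 (Omega T) (Omega T) -> S1 (OpenCov T) (OpenCov T).
Proof.
move=> roth U UO.
have /choice[W WP] : forall n, exists W : nat -> set T, U n = range W.
  move=> n; have [[U0 _ _] /countable_nonempty_range/(_ U0)[W]] := UO n.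
  by exists W.
have oW n i : open (W n i).
  by have [[_ + _] _] := UO n; apply; rewrite WP; exists i.
have cW n x : exists i, W n i x.
  have [[_ _ /seteqP[_ /(_ x Logic.I)[V UV Vx]]] _] := UO n.
  by move: UV Vx; rewrite WP => -[i _ <-]; exists i.
pose E n (s : seq nat) :=
  \bigcup_(i < size s) W (pair_code n i) (nth 0%N s i).
have [s sP] : exists s : nat -> seq nat, forall x, exists n, E n (s n) x.
  have [[n [s ET]]|ET] := pselect (exists n s, E n s = setT).
    by exists (fun=> s) => x; exists n; rewrite ET.
  have EO n : Omega T (range (E n)).
    split; last exact: countType_range_countable.
    apply: (omega_cover_range [::]) => [s|s sT|F /finite_seqP[xs ->]].
    - by apply: bigcup_open => i _; exact: oW.
    - by apply: ET; exists n, s.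
    - have /choice[f fP] := fun ix : nat * T => cW (pair_code n ix.1) ix.2.
      case: xs => [|x0 xs']; first by exists [::].
      set xs := x0 :: xs'.
      exists (mkseq (fun i => f (i, nth x0 xs i)) (size xs)) => x /= xxs.
      exists (index x xs); first by rewrite /mkset size_mkseq index_mem.
      rewrite nth_mkseq ?index_mem// nth_index//; exact: fP (index x xs, x).
  have [V VE [[[_ _ cV] _ _] _]] := roth _ EO.
  have /choice[s sP] : forall n, exists s, V n = E n s.
    by move=> n; have [s _ <-] := VE n; exists s.
  exists s => x; move/seteqP: cV => [_ /(_ x Logic.I)[_ [n _ <-]]].
  by rewrite /= sP => Ex; exists n.
pose V k := W k (nth 0%N (s (pair_decode k).1) (pair_decode k).2).
exists V.
  move=> k; rewrite WP.
  by exists (nth 0%N (s (pair_decode k).1) (pair_decode k).2).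
split; last exact: countType_range_countable.
split; first by exists (V 0%N), 0%N.
- by move=> _ [k _ <-]; exact: oW.
- apply/seteqP; split => // x _; have [n [i /= _ Wx]] := sP x.
  exists (V (pair_code n i)); first by exists (pair_code n i).
  by rewrite /V pair_codeK.
Qed.

Section real_sets.
Variable R : realType.

(** Strong measure zero with arbitrary sets replaced by balls, whose centers
    may lie outside of X. *)
Definition small_balls (X : set R) : Prop :=
  forall e : nat -> R, (forall n, 0 < e n) ->
    exists p : nat -> R, forall x, X x -> exists n, `|x - p n| < e n.

(** A nonempty set of diameter less than e_n lies in the ball of radius e_n
    around any of its points; a ball of radius e_n/3 has diameter less than
    e_n. *)
Lemma strong_measure_zeroP (X : set R) :
  strong_measure_zero X <-> small_balls X.
Proof.
split=> smz e e0.
  have [I IX Ie] := smz e e0.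
  exists (fun n => xget 0 (I n)) => x; rewrite -IX => -[n _ Ix]; exists n.
  rewrite -lte_fin; apply: le_lt_trans (Ie n); apply: ereal_sup_ubound; right.
  by exists x => //; exists (xget 0 (I n)) => //; exact: xgetI Ix.
have [|p pP] := smz (fun n => e n / 3%:R).
  by move=> n; rewrite divr_gt0.
exists (fun n => X `&` [set x | `|x - p n| < e n / 3%:R]).
  apply/seteqP; split => [x [n _ []]//|x Xx].
  by have [n xn] := pP x Xx; exists n.
move=> n; have en := e0 n.
apply: (@le_lt_trans _ _ ((e n / 3%:R) *+ 2)%:E); last first.
  by rewrite lte_fin; lra.
apply: ge_ereal_sup => _ [->|[x [_ /= xn] [y [_ /= yn] <-]]].
  by rewrite lee_fin; lra.
rewrite lee_fin (le_trans (ler_distD (p n) _ _))// (distrC (p n)).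
by rewrite mulr2n lerD// ltW.
Qed.

Lemma dense_sequence : exists q : nat -> R,
  forall x e : R, 0 < e -> exists i, `|x - q i| < e.
Proof.
exists (fun i => ratr (odflt 0 (unpickle i))) => x e e0.
have [y [xe [r _ rE]]] :=
  dense_rat (ex_intro _ x (ballxx x e0)) (ball_open x e).
by exists (pickle r); rewrite pickleK/= rE.
Qed.

Variable X : set R.

Lemma open_set_typeP (V : set X) : open V <->
  forall x, V x ->
    exists2 r, 0 < r & forall y : X, `|\val y - \val x| < r -> V y.
Proof.
split=> [[G oG <-] x Gx|H].
  have /nbhs_ballP[r r0 rG] : nbhs (\val x) G by exact: open_nbhs_nbhs.
  by exists r => // y yx; apply: rG; rewrite -ball_normE /= distrC.
exists (\bigcup_(xr in [set xr : X * R | 0 < xr.2 /\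
    forall y : X, `|\val y - \val xr.1| < xr.2 -> V y]) ball (\val xr.1) xr.2).
  by apply: bigcup_open => -[x r] [r0 _]; exact: ball_open.
apply/seteqP; split => [y [[x r] [/= r0 rV]]|x /[dup] Vx /H[r r0 rV]].
  by rewrite -ball_normE /= distrC; exact: rV.
by exists (x, r) => //; exact: ballxx.
Qed.

Lemma S1_OpenCov_small_balls : S1 (OpenCov X) (OpenCov X) -> small_balls X.
Proof.
move=> roth e e0; have [q qP] := dense_sequence.
pose W n i := [set x : X | `|\val x - q i| < e n].
have [|V VW [[_ _ /seteqP[_ cV]] _]] := roth (fun n => range (W n)).
  move=> n; split; last exact: countType_range_countable.
  split; first by exists (W n 0%N), 0%N.
  - move=> _ [i _ <-]; apply/open_set_typeP => x /= xi.
    exists (e n - `|\val x - q i|); first by rewrite subr_gt0.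
    by move=> y yx; apply: le_lt_trans (ler_distD (\val x) _ _) _; lra.
  - apply/seteqP; split => // x _; have [i xi] := qP (\val x) _ (e0 n).
    by exists (W n i) => //; exists i.
have /choice[j jP] : forall n, exists i, V n = W n i.
  by move=> n; have [i _ <-] := VW n; exists i.
exists (fun n => q (j n)) => x Xx.
have [_ [n _ <-]] := cV (SigSub (mem_set Xx)) Logic.I.
by rewrite /= jP => xn; exists n.
Qed.

End real_sets.

(** * Small balls in blocks and in finite powers *)

Section small_balls_powers.
Variables (R : realType) (X : set R).

(** The length of a block is known only after a covering by balls is chosen,
    while the radii depend on the place where the block starts.  So a covering
    is chosen for every possible start s, and the Hurewicz property bounds, for
    all s at once, the number of balls that are needed. *)
Lemma hurewicz_small_balls_blocks : omega_hurewicz X -> small_balls X ->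
  forall e : nat -> R, (forall n, 0 < e n) ->
  exists (p : nat -> R) (m : nat -> nat),
    [/\ m 0%N = 0%N, forall k, (m k < m k.+1)%N &
        forall x, X x -> \forall k \near \oo,
          exists2 n, (m k <= n < m k.+1)%N & `|x - p n| < e n].
Proof.
move=> hur smz e e0.
have /choice[p pP] : forall s, exists p : nat -> R, forall x, X x -> exists n,
    `|x - p n| < e (s + n)%N by move=> s; exact: smz.
pose W s i : set X :=
  \bigcup_(n < i) [set x | `|\val x - p s n| < e (s + n)%N].
have [s i|s F finF|g gP] := hur W.
- apply: bigcup_open => n _; apply/open_set_typeP => x /= xn.
  exists (e (s + n)%N - `|\val x - p s n|); first by rewrite subr_gt0.
  by move=> y yx; apply: le_lt_trans (ler_distD (\val x) _ _) _; lra.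
- have /choice[f fP] : forall x : X, exists n, `|\val x - p s n| < e (s + n)%N.
    by move=> x; apply: pP; exact: set_valP.
  have [i iP] := finite_set_nat_bound f finF.
  by exists i => x Fx; exists (f x); [exact: iP|exact: fP].
have [v [m [m0 mS vE]]] :=
  block_sequence (fun h n => p (size h) n) (fun h => g (size h)).
have ltm k : (m k < m k.+1)%N by rewrite mS -addn1 leq_add2l.
exists v, m; split=> // x Xx.
have [N _ NP] := gP _ (finite_set1 (SigSub (mem_set Xx) : X)).
exists N => // k /= Nk.
have [i ig /(_ _ erefl)[n /= ni xn]] :=
  NP (m k) (leq_trans Nk (block_ge ltm k)).
have nk : (m k <= m k + n < m k.+1)%N.
  by rewrite leq_addr mS size_mkseq ltn_add2l ltnS ltnW// (ltn_trans ni).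
by exists (m k + n)%N => //; rewrite (vE k)// addKn size_mkseq.
Qed.

(** Each D_j is covered infinitely many times, each time with its own infinite
    part of the sequence of radii. *)
Lemma small_balls_interleave (S T : Type) (B : R -> S -> T -> Prop)
    (D : nat -> set T) :
  (forall j (e : nat -> R), (forall n, 0 < e n) ->
    exists s : nat -> S, forall t, D j t -> exists n, B (e n) (s n) t) ->
  forall e : nat -> R, (forall n, 0 < e n) ->
    exists s : nat -> S, forall j t N, D j t ->
      exists2 n, (N <= n)%N & B (e n) (s n) t.
Proof.
move=> H e e0.
have /choice[s sP] : forall a, exists s : nat -> S, forall t,
    D (pair_decode a).2 t -> exists n, B (e (pair_code a n)) (s n) t.
  by move=> a; exact: (H _ (fun n => e (pair_code a n))).
exists (fun n => s (pair_decode n).1 (pair_decode n).2) => j t N Dt.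
have [|n Bn] := sP (pair_code N j) t; first by rewrite pair_codeK.
exists (pair_code (pair_code N j) n); last by rewrite pair_codeK.
exact: leq_trans (leq_pair_code _ _) (leq_pair_code _ _).
Qed.

Lemma positive_lower_bound (e : nat -> R) N : (forall n, 0 < e n) ->
  exists2 d, 0 < d & forall n, (n < N)%N -> d <= e n.
Proof.
move=> e0; elim: N => [|N [d d0 dP]]; first by exists 1.
exists (Num.min d (e N)); first by rewrite lt_min d0 e0.
move=> n; rewrite ltnS leq_eqVlt => /orP[/eqP ->|/dP de].
  by rewrite ge_min lexx orbT.
by rewrite ge_min de.
Qed.

(** Lists stand for finite sets.  Entrywise closeness gives both inclusions of
    each set in a neighbourhood of the other. *)
Definition close_seq (e : R) (s t : seq R) : bool :=
  all2 (fun a b => `|b - a| < e) s t.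

Lemma close_seqW (e e' : R) s t :
  e <= e' -> close_seq e s t -> close_seq e' s t.
Proof.
move=> ee'; elim: s t => [|a s IH] [|b t]//= /andP[ab /IH st].
by apply/andP; split=> //; exact: lt_le_trans ab ee'.
Qed.

Lemma close_seq_left (e : R) s t a : close_seq e s t -> a \in s ->
  exists2 b, b \in t & `|b - a| < e.
Proof.
elim: s t => [|a' s IH] [|b t]//= /andP[ab st].
rewrite inE => /orP[/eqP ->|/(IH _ st)[c ct ca]].
  by exists b => //; rewrite mem_head.
by exists c => //; rewrite inE ct orbT.
Qed.

Lemma close_seq_right (e : R) s t b : close_seq e s t -> b \in t ->
  exists2 a, a \in s & `|b - a| < e.
Proof.
elim: s t => [|a s IH] [|b' t]//= /andP[ab st].
rewrite inE => /orP[/eqP ->|/(IH _ st)[c cs ca]].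
  by exists a => //; rewrite mem_head.
by exists c => //; rewrite inE cs orbT.
Qed.

(** A tuple t of length j is covered infinitely often also with radii so small
    that the kth one is at most the radius of every ball in the kth block.  One
    more point x is covered in almost every block, so x and t are covered
    together when the kth ball for tuples is repeated along the kth block. *)
Lemma small_balls_tuples : omega_hurewicz X -> small_balls X ->
  forall j (e : nat -> R), (forall n, 0 < e n) ->
  exists s : nat -> seq R, forall t,
    size t = j /\ {in t, forall x, X x} -> exists n, close_seq (e n) (s n) t.
Proof.
move=> hur smz; elim=> [|j IH] e e0.
  by exists (fun=> [::]) => t [/size0nil -> _]; exists 0%N.
have [p [m [m0 mS pP]]] := hurewicz_small_balls_blocks hur smz e0.
have /choice[d dP] : forall k, exists d,
    0 < d /\ forall n, (n < m k.+1)%N -> d <= e n.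
  move=> k; have [d d0 dP] := positive_lower_bound (m k.+1) e0.
  by exists d.
have [|s sP] := small_balls_interleave (B := close_seq) (fun=> IH) (e := d).
  by move=> k; case: (dP k).
have /choice[b bP] := block_exists m0 mS.
exists (fun n => p n :: s (b n)) => -[|x t] [//= [tj] tX].
have [N _ NP] := pP x (tX x (mem_head _ _)).
have [|k Nk st] := sP 0%N t N.
  by split=> // y yt; apply: tX; rewrite inE yt orbT.
have [n kn xn] := NP k Nk.
exists n; rewrite /close_seq/= xn/= (block_unique mS (bP n) kn).
by apply: close_seqW st; apply: (dP k).2; case/andP: kn.
Qed.

Lemma small_balls_finite_sets : omega_hurewicz X -> small_balls X ->
  forall e : nat -> R, (forall n, 0 < e n) ->
  exists s : nat -> seq R, forall t N, {in t, forall x, X x} ->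
    exists2 n, (N <= n)%N & close_seq (e n) (s n) t.
Proof.
move=> hur smz e e0.
have [s sP] := small_balls_interleave (B := close_seq)
  (small_balls_tuples hur smz) e0.
by exists s => t N tX; apply: (sP (size t)).
Qed.

(** The points around which [W] contains a ball of radius larger than
    1 / (k + 1); with radius exactly 1 / (k + 1) they need not form an open
    set. *)
Let deep (W : set X) (k : nat) : set X :=
  [set x | exists2 r, k.+1%:R^-1 < r &
     forall y : X, `|\val y - \val x| < r -> W y].

Let open_deep W k : open (deep W k).
Proof.
apply/open_set_typeP => x [r kr rW].
rewrite /deep /=; move: (k.+1%:R^-1) kr => c cr.
exists ((r - c) / 2%:R); first by rewrite divr_gt0// subr_gt0.
move=> y yx; exists ((r + c) / 2%:R); first by lra.
move=> z zy; apply: rW.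
by apply: le_lt_trans (ler_distD (\val y) _ _) _; lra.
Qed.

Let deepW W k k' : (k <= k')%N -> deep W k `<=` deep W k'.
Proof.
move=> kk' x [r kr rW]; exists r => //; apply: le_lt_trans kr.
by rewrite lef_pV2 ?posrE// ler_nat.
Qed.

(** The sets [deep (W n i) k] with varying i and k form an omega-cover, and
    only finitely many values of k occur in a finite part of it. *)
Lemma hurewicz_lebesgue_numbers (W : nat -> nat -> set X) :
  omega_hurewicz X -> (forall n i, open (W n i)) ->
  (forall n, omega_seq (W n)) ->
  exists2 r : nat -> R, (forall n, 0 < r n) & forall F : set X, finite_set F ->
    \forall n \near \oo, exists i, forall x, F x ->
      forall y : X, `|\val y - \val x| < r n -> W n i y.
Proof.
move=> hur oW cW.
have [//|n F finF|g gP] :=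
    hur (fun n a => deep (W n (pair_decode a).1) (pair_decode a).2).
  have [i Fi] := cW n F finF.
  have /(choice_in 0%N)[f fP] : forall x, F x -> exists k, deep (W n i) k x.
    move=> x /Fi Wx; have /open_set_typeP/(_ x Wx)[r r0 rW] := oW n i.
    have [k _ kr] := near_infty_natSinv_lt (PosNum r0).
    by exists k, r => //; exact: (kr k (leqnn k)).
  have [K KP] := finite_set_nat_bound f finF.
  exists (pair_code i K) => x Fx; rewrite pair_codeK/=.
  by apply: deepW (fP x Fx); exact/ltnW/KP.
have /choice[M MP] := fun n =>
  finite_set_nat_bound (fun a => (pair_decode a).2) (finite_II (g n)).
exists (fun n => (M n).+1%:R^-1) => [n|F /gP[N _ NP]].
  by rewrite invr_gt0.
exists N => // n /NP[a ag Fa]; exists (pair_decode a).1 => x /Fa[r ar rW] y yx.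
apply: rW; apply: lt_trans yx _; apply: le_lt_trans ar.
by rewrite lef_pV2 ?posrE// ler_nat ltnS ltnW// MP.
Qed.

(** The nth selected set contains the r_n/2-neighbourhood of the finite set
    s_n, if some set of the nth row does.  This is the case whenever s_n is
    r_n/2-close to a finite set F whose r_n-neighbourhood is contained in a set
    of the nth row; and then the selected set contains F. *)
Lemma hurewicz_small_balls_S1_Omega :
  omega_hurewicz X -> small_balls X -> S1 (Omega X) (Omega X).
Proof.
move=> hur smz U UO.
have /choice[W WP] := fun n => Omega_range (UO n).
have [|n|r r0 rP] := hurewicz_lebesgue_numbers (W := W) hur.
- by move=> n i; case: (WP n).
- by case: (WP n).
have [|s sP] := small_balls_finite_sets hur smz (e := fun n => r n / 2%:R).
  by move=> n; rewrite divr_gt0.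
pose Q n i := forall (y : X) a,
  a \in s n -> `|\val y - a| < r n / 2%:R -> W n i y.
have /(choice_in 0%N)[f fP] :
  forall n, (exists i, Q n i) -> exists i, Q n i by [].
exists (fun n => W n (f n)).
  by move=> n; case: (WP n) => -> _ _ _; exists (f n).
split; last exact: countType_range_countable.
apply: (omega_cover_range 0%N) => [n|n|F finF].
- by case: (WP n).
- by case: (WP n).
have [N _ NP] := rP F finF; move/finite_seqP: finF => [t FE].
have [|n Nn st] := sP (map \val t) N.
  by move=> _ /mapP[x _ ->]; exact: set_valP.
exists n => x; rewrite FE /= => xt.
have [i iP] := NP n Nn.
have Qi : Q n i.
  move=> y a /(close_seq_left st)[_ /mapP[z zt ->] za] ya.
  apply: (iP z); first by rewrite FE.
  by apply: le_lt_trans (ler_distD a _ _) _; rewrite (distrC a); lra.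
have [a sa xa] := close_seq_right st (map_f \val xt).
exact: (fP n (ex_intro _ i Qi) x a sa xa).
Qed.

End small_balls_powers.

(** * Meager sets *)

Section meager_sets.
Variable R : realType.
Implicit Types (A C M S X : set R).

Lemma nowhere_denseP A : nowhere_dense A <->
  forall a h : R, 0 < h -> exists b r, [/\ 0 < r, `|b - a| < h &
    forall y, `|y - b| < r -> ~ A y].
Proof.
split=> [nA a h h0|nA].
  have /existsNP[b /not_implyP[ab nAb]] : ~ (ball a h `<=` closure A).
    move=> hA; suff : (closure A)° a by rewrite nA.
    by apply/nbhs_ballP; exists h.
  have [r /= r0 rA] : exists2 r : R, 0 < r & forall y, ball b r y -> ~ A y.
    apply: contrapT => nr; apply: nAb => B /nbhs_ballP[r /= r0 rB].
    apply: contrapT => nAB; apply: nr; exists r => // y yb Ay.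
    by apply: nAB; exists y; split => //; exact: rB.
  exists b, r; split => //; first by move: ab; rewrite -ball_normE /= distrC.
  by move=> y yb; apply: rA; rewrite -ball_normE /= distrC.
apply/seteqP; split => // a /nbhs_ballP[h /= h0 hA].
have [b [r [r0 ab rA]]] := nA a h h0.
have /hA Ab : ball a h b by rewrite -ball_normE /= distrC.
have [y [Ay]] := Ab _ (nbhsx_ballx b r r0).
by rewrite -ball_normE /= distrC => /rA.
Qed.

Lemma nowhere_dense_sub A C : A `<=` C -> nowhere_dense C -> nowhere_dense A.
Proof.
move=> AC /nowhere_denseP nC; apply/nowhere_denseP => a h.
move=> /(nC a)[b [r [r0 ab rC]]].
by exists b, r; split => // y /rC nCy /AC.
Qed.

Lemma meager_sub_bigcup S (D : nat -> set R) :
  (forall n, meager (D n)) -> S `<=` \bigcup_n D n -> meager S.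
Proof.
move=> mD SD.
have /choice[A AP] : forall n, exists A : nat -> set R,
    (forall i, nowhere_dense (A i)) /\ D n = \bigcup_i A i.
  by move=> n; have [A nA DA] := mD n; exists A.
exists (fun k => S `&` A (pair_decode k).1 (pair_decode k).2).
  move=> k.
  apply: (nowhere_dense_sub _ ((AP (pair_decode k).1).1 (pair_decode k).2)).
  exact: subIsetr.
apply/seteqP; split => [x Sx|x [k _ []]//].
have [n _] := SD x Sx; rewrite (AP n).2 => -[i _ Ax].
by exists (pair_code n i) => //; rewrite pair_codeK.
Qed.

Lemma nowhere_dense_meager A : nowhere_dense A -> meager A.
Proof.
by move=> nA; exists (fun=> A) => //; rewrite bigcup_const//; exists 0%N.
Qed.

Lemma meager_neq_setT M : meager M -> exists y, ~ M y.
Proof.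
move=> [A nA ME].
have [||y [_ Ay]] := @Baire R R (fun n => ~` closure (A n)) _ setT _ openT.
- move=> n; split; first exact/closed_openC/closed_closure.
  move=> G [a Ga] oG.
  have /nbhs_ballP[h /= h0 hG] : nbhs a G by exact: open_nbhs_nbhs.
  have /nowhere_denseP/(_ a h h0)[b [r [r0 ab rA]]] := nA n.
  exists b; split; first by apply: hG; rewrite -ball_normE /= distrC.
  move=> /(_ _ (nbhsx_ballx b r r0))[y [Ay]].
  by rewrite -ball_normE /= distrC => /rA.
- by exists 0.
- exists y; rewrite ME => -[n _ Any].
  by apply: (Ay n) => //; exact: subset_closure.
Qed.

(** The points at distance at least e_n from the nth term of a dense sequence
    q, for all n, form a nowhere dense set M.  If y is not in X + M, then every
    y - x with x in X is close to some q_n. *)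
Lemma meager_additive_small_balls X : meager_additive X -> small_balls X.
Proof.
move=> maX e e0; have [q qP] := dense_sequence R.
pose M := [set m | forall n, e n <= `|m - q n|].
have /maX/meager_neq_setT[y yXM] : meager M.
  apply/nowhere_dense_meager/nowhere_denseP => a h h0.
  have [n an] := qP a h h0; exists (q n), (e n).
  by rewrite distrC; split => // z zn /(_ n); rewrite leNgt zn.
exists (fun n => y - q n) => x Xx.
have /existsNP[n] : ~ M (y - x).
  move=> Myx; apply: yXM; exists x => //; exists (y - x) => //.
  by rewrite addrC subrK.
move=> /negP; rewrite -ltNge => yxn; exists n.
by rewrite (_ : x - _ = - (y - x - q n)) ?normrN//; lra.
Qed.

(** For a single position a this is the definition of nowhere dense, and the
    same d' serves for all positions near a.  By compactness it can be chosen
    uniformly on an interval; outside of a large interval the set C is far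
    away. *)
Lemma bounded_nowhere_dense_gap C (K d : R) : (forall c, C c -> `|c| <= K) ->
  nowhere_dense C -> 0 < d ->
  exists d', [/\ 0 < d', d' <= d / 2%:R & forall a, exists b,
    `|b - a| + d' <= d /\ forall c, C c -> d' *+ 2 < `|b - c|].
Proof.
move=> CK /nowhere_denseP nC d0.
pose P (i : nat) a := exists b, `|b - a| + i.+1%:R^-1 <= d /\
  forall c, C c -> i.+1%:R^-1 *+ 2 < `|b - c|.
have small (h : R) : 0 < h -> \forall i \near \oo, i.+1%:R^-1 *+ 2 < h.
  move=> h0; have h20 : 0 < h / 2%:R by rewrite divr_gt0.
  apply: filterS (near_infty_natSinv_lt (PosNum h20)) => i /=.
  by move: (_^-1) => c ch; rewrite mulr2n; lra.
have : \forall i \near \oo, `[- (K + d), K + d]%classic `<=` P i.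
  have /compact_near_coveringP := @segment_compact R (- (K + d)) (K + d).
  apply => a _.
  have [|b [r [r0 ab rC]]] := nC a (d / 2%:R); first by rewrite divr_gt0.
  have d40 : 0 < d / 4%:R by rewrite divr_gt0.
  exists (ball a (d / 4%:R),
          [set i | i.+1%:R^-1 *+ 2 < r /\ i.+1%:R^-1 *+ 2 < d / 4%:R]) => /=.
    split; first exact: nbhsx_ballx.
    by apply: filterI; exact: small.
  move=> [a' i] /= []; rewrite -ball_normE /= => aa'.
  rewrite /P; move: (_^-1) => c [cr cd]; exists b; split.
    (* The distance is below d/2 + d/4, and c is below d/8. *)
    suff : `|b - a'| < d / 2%:R + d / 4%:R by move: cd; rewrite mulr2n; lra.
    by apply: le_lt_trans (ler_distD a _ _) _; exact: ltrD.
  move=> x Cx; apply: (lt_le_trans cr); rewrite leNgt; apply/negP => bx.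
  by apply: (rC x _ Cx); rewrite distrC.
move=> /(filterI (small d d0))/filter_ex[i [id iP]].
exists i.+1%:R^-1; split; first by rewrite invr_gt0.
  by move: id; move: (_^-1) => c; rewrite mulr2n; lra.
move=> a; have [aK|aK] := leP `|a| (K + d).
  by apply: iP; rewrite /= in_itv/= -ler_norml.
exists a; rewrite subrr normr0 add0r; split.
  have : 0 < i.+1%:R^-1 :> R by rewrite invr_gt0.
  by move: id; move: (_^-1) => c; rewrite mulr2n; lra.
move=> c Cc; apply: (lt_trans id); apply: lt_le_trans (lerB_dist _ _).
by have := CK c Cc; lra.
Qed.

Section bounded_translates.
Variables (X C : set R) (K : R).
Hypotheses (hur : omega_hurewicz X) (smz : small_balls X).
Hypotheses (CK : forall c, C c -> `|c| <= K) (nC : nowhere_dense C).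

(** Let d_0, d_1, ... be obtained by iterating the gap lemma, and cover X in
    blocks by balls around p_n of radius d_(n+1).  The points x that are
    covered within all blocks from the lth on form a set Z_l, and X is
    contained in the union of them.  Every Z_l + C is nowhere dense: given an
    interval of radius d_n, where n is the start of a late block, pass through
    the block, at each step i to a subinterval of radius d_(i+1) that misses
    all translates x + C with x in the ith ball. *)
Lemma meager_add_bounded : meager [set x + c | x in X & c in C].
Proof.
have /(choice_in 0)[f fP] : forall d : R, 0 < d -> exists d',
    [/\ 0 < d', d' <= d / 2%:R & forall a, exists b,
    `|b - a| + d' <= d /\ forall c, C c -> d' *+ 2 < `|b - c|].
  by move=> d d0; exact: bounded_nowhere_dense_gap CK nC d0.
pose d n := iter n f 1.
have d0 n : 0 < d n.
  by elim: n => // n IH; case: (fP _ IH).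
have d_small (h : R) : 0 < h -> exists N, forall n, (N <= n)%N -> d n < h.
  move=> h0.
  have dn n : d n <= n.+1%:R^-1.
    elim: n => [|n IH]; first by rewrite invr1.
    apply: (@le_trans _ _ (d n / 2%:R)); first by case: (fP _ (d0 n)).
    apply: (@le_trans _ _ (n.+1%:R^-1 / 2%:R)).
      by rewrite ler_pM2r ?invr_gt0.
    rewrite -invfM -natrM lef_pV2 ?posrE// ler_nat.
    by rewrite muln2 doubleS !ltnS -addnn leq_addr.
  have [N _ NP] := near_infty_natSinv_lt (PosNum h0).
  by exists N => n Nn; apply: (le_lt_trans (dn n)); exact: NP.
have [p [m [m0 mS pP]]] :=
  hurewicz_small_balls_blocks hur smz (fun n => d0 n.+1).
(* At the ith step the gap lemma is applied to the interval translated by - p_i;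
   a distance larger than 2 d_(i+1) from C leaves room for a point of the new
   interval and for the difference between x and p_i. *)
have nest n k a : exists b, `|b - a| + d (n + k)%N <= d n /\
    forall i x c, (n <= i < n + k)%N -> `|x - p i| < d i.+1 -> C c ->
    forall y, `|y - b| < d (n + k)%N -> y <> x + c.
  elim: k => [|k [b [ba bP]]].
    exists a; rewrite subrr normr0 add0r addn0; split => // i x c.
    by case/andP => ni /(leq_ltn_trans ni); rewrite ltnn.
  have [_ _ /(_ (b - p (n + k)%N))[b' [b'b b'C]]] := fP _ (d0 (n + k)%N).
  rewrite addnS; exists (b' + p (n + k)%N); split.
    have := ler_distD b (b' + p (n + k)%N) a.
    rewrite (_ : b' + _ - b = b' - (b - p (n + k)%N)); last by lra.
    by move: b'b; rewrite -[f _]/(d (n + k).+1); lra.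
  move=> i x c /andP[ni]; rewrite ltnS leq_eqVlt => /predU1P[->|ik] xi Cc y yb.
    move=> yE; move: (b'C c Cc).
    rewrite -[f _]/(d (n + k).+1) ltNge => /negP; apply.
    apply: (le_trans (ler_distD (y - p (n + k)%N) _ _)).
    rewrite mulr2n lerD//.
      by rewrite distrC (_ : _ - b' = y - (b' + p (n + k)%N)) ?ltW//; lra.
    by rewrite yE (_ : _ - c = x - p (n + k)%N) ?ltW//; lra.
  apply: (bP i x c) => //; first by rewrite ni.
  apply: le_lt_trans (ler_distD (b' + p (n + k)%N) _ _) _.
  rewrite (_ : b' + _ - b = b' - (b - p (n + k)%N)); last by lra.
  by move: b'b yb; rewrite -[f _]/(d (n + k).+1); lra.
pose Z l := [set x | forall k, (l <= k)%N ->
  exists2 n, (m k <= n < m k.+1)%N & `|x - p n| < d n.+1].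
apply: (meager_sub_bigcup (D := fun l => [set x + c | x in Z l & c in C])).
  move=> l; apply/nowhere_dense_meager/nowhere_denseP => a h /d_small[N NP].
  pose k := maxn l N.
  have mkh : d (m k) < h.
    by apply: NP; apply: (leq_trans (leq_maxr l N)); exact: block_ge.
  have [b []] := nest (m k) (m k.+1 - m k)%N a.
  rewrite subnKC; last exact: ltnW.
  move=> ba bP; exists b, (d (m k.+1)); split => //.
    by have := d0 (m k.+1); lra.
  move=> y yb [x Zx [c Cc yE]].
  have [n kn xn] := Zx k (leq_maxl l N).
  exact: (bP n x c kn xn Cc y yb).
move=> _ [x Xx [c Cc <-]]; have [l _ lP] := pP x Xx.
by exists l => //; exists x; [move=> k /lP|exists c].
Qed.

End bounded_translates.

(** A meager set is a countable union of bounded nowhere dense sets. *)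
Lemma hurewicz_small_balls_meager_additive X :
  omega_hurewicz X -> small_balls X -> meager_additive X.
Proof.
move=> hur smz M [A nA ->].
pose C k := A (pair_decode k).1 `&` [set c | `|c| <= (pair_decode k).2%:R].
apply: (meager_sub_bigcup (D := fun k => [set x + c | x in X & c in C k])).
  move=> k; apply: (meager_add_bounded (K := (pair_decode k).2%:R)) => //.
    by move=> c [].
  exact: (nowhere_dense_sub (@subIsetl _ _ _) (nA (pair_decode k).1)).
move=> _ [x Xx [c [n _ Ac] <-]].
have [i ci] : exists i : nat, `|c| <= i%:R.
  by exists (Num.bound `|c|); rewrite ltW// archi_boundP.
exists (pair_code n i) => //; exists x => //; exists c => //.
by rewrite /C pair_codeK.
Qed.

End meager_sets.

(** * The equivalence *)

Section S1_consequences.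
Variable T : topologicalType.

Lemma S1_Omega_gp_S1_Omega :
  S1 (Omega T) (Omega_gp T) -> S1 (Omega T) (Omega T).
Proof.
move=> s1 U /s1[V VU [cV _]]; exists V => //.
by split=> //; exact: countType_range_countable.
Qed.

Lemma S1_Omega_gp_Sfin :
  S1 (Omega T) (Omega_gp T) -> Sfin (Omega T) (Omega_gp T).
Proof.
move=> s1 U /s1[V VU cV]; exists (fun n => [set V n]).
  by move=> n; split; [move=> _ ->|exact: finite_set1].
rewrite (_ : \bigcup_n _ = range V)//; apply/seteqP; split.
  by move=> _ [n _ ->]; exists n.
by move=> _ [n _ <-]; exists n.
Qed.

End S1_consequences.

Theorem theorem4p3 (R : realType) (X : set R) :
  [<-> Sfin (Omega X) (Omega_gp X) /\
         strong_measure_zero X;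
       Sfin (Omega X) (Omega_gp X) /\
         S1 (OpenCov X) (OpenCov X);
       Sfin (Omega X) (Omega_gp X) /\
         meager_additive X;
       Sfin (Omega X) (Omega_gp X) /\
         S1 (Omega X) (Omega X);
       S1 (Omega X) (Omega_gp X)].
Proof.
tfae.
- move=> [sfin /strong_measure_zeroP smz]; split=> //.
  apply: S1_Omega_OpenCov; apply: hurewicz_small_balls_S1_Omega => //.
  exact: Sfin_Omega_gp_hurewicz.
- move=> [sfin /S1_OpenCov_small_balls smz]; split=> //.
  apply: hurewicz_small_balls_meager_additive => //.
  exact: Sfin_Omega_gp_hurewicz.
- move=> [sfin /meager_additive_small_balls smz]; split=> //.
  apply: hurewicz_small_balls_S1_Omega => //.
  exact: Sfin_Omega_gp_hurewicz.
- move=> [sfin]; apply: S1_Omega_gp; exact: Sfin_Omega_gp_hurewicz.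
- move=> s1gp; split; first exact: S1_Omega_gp_Sfin.
  apply/strong_measure_zeroP/S1_OpenCov_small_balls/S1_Omega_OpenCov.
  exact: S1_Omega_gp_S1_Omega.
Qed.
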